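(* Let $(\Sigma,A)$ be a finitary algebra whose underlying set $A$ is finite. Then the following are equivalent: (1) $(\Sigma^A)^{\perp\perp(\aleph_0)} = \langle \Sigma^A\rangle_{\aleph_0}$; (2) for every finitary operation $f:A^n \rightarrow A$, if $f \notin \langle \Sigma^A\rangle_{\aleph_0}$ then there exists some $\Sigma$-homomorphism $h:A^{(A^n)} \rightarrow A$ such that $h(f) \neq f\bigl((h(\pi_i))_{i \in n}\bigr)$, where $\pi_i:A^n\to A$ $(i\in n)$ denote the projections.
   Context: A finitary operation on a set $A$ is a map $A^n\to A$ with $n$ a finite cardinal ($n=\{0,\dots,n-1\}$; $n=0$ is allowed). A finitary signature is a set $\Sigma$ with an assignment of a finite cardinal, its arity, to each $\sigma\in\Sigma$. A $\Sigma$-algebra is a set $A$ equipped with an operation $\sigma^A:A^n\to A$ for each $\sigma\in\Sigma$, where $n$ is the arity of $\sigma$; a $\Sigma$-homomorphism is a map preserving these basic operations. A finitary algebra is a pair $(\Sigma,A)$ of a finitary signature $\Sigma$ and a $\Sigma$-algebra $A$; write $\Sigma^A=\{\sigma^A\mid\sigma\in\Sigma\}$. Each power $A^Y$ is a $\Sigma$-algebra under the pointwise operations; in particular $A^{(A^n)}$ is a $\Sigma$-algebra. A finitary clone on $A$ is a set $F$ of finitary operations on $A$ that contains all projections $\pi_i:A^n\to A$ and is such that for every $f:A^m\to A$ in $F$ and every family $g_j:A^n\to A$ $(j\in m)$ in $F$, the composite $f\circ(g_j)_{j\in m}:A^n\to A$ lies in $F$. $\langle\Sigma^A\rangle_{\aleph_0}$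 (the clone of finitary derived operations) is the smallest finitary clone on $A$ containing $\Sigma^A$. Operations $f:A^n\to A$ and $g:A^m\to A$ commute, written $f\perp g$, if for every matrix $a=(a_{ij})\in A^{n\times m}$ one has $g\bigl((f((a_{ij})_{i\in n}))_{j\in m}\bigr)=f\bigl((g((a_{ij})_{j\in m}))_{i\in n}\bigr)$. For a set $G$ of finitary operations on $A$, $G^{\perp(\aleph_0)}$ is the set of all finitary operations $f$ on $A$ with $f\perp g$ for all $g\in G$, and $G^{\perp\perp(\aleph_0)}$ is the result of applying $(-)^{\perp(\aleph_0)}$ twice to $G$. In $h(f)$, the map $f:A^n\to A$ is regarded as an element of $A^{(A^n)}$. *)

(* Defs.v *)
From mathcomp Require Import all_boot all_algebra.
From mathcomp Require Import classical_sets.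

Set Implicit Arguments.
Unset Strict Implicit.
Unset Printing Implicit Defensive.

Local Open Scope classical_set_scope.

Definition operation (A : Type) (n : nat) : Type := {ffun 'I_n -> A} -> A.

(* Operations of all arities form a single type, so that a set of finitary
   operations is a [set (finop A)] and equality of such sets is plain [=]. *)
Record finop (A : Type) : Type :=
  Finop { finop_arity : nat; finop_fun : operation A finop_arity }.
Arguments Finop {A finop_arity} _.
Arguments finop_arity {A} _.
Arguments finop_fun {A} _ _.

Definition proj (A : Type) (n : nat) (i : 'I_n) : operation A n :=
  fun x => x i.
Arguments proj {A n} i.

Definition compose (A : Type) (m n : nat) (f : operation A m)
    (g : 'I_m -> operation A n) : operation A n :=
  fun x => f [ffun j => g j x].

Record signature : Type := Signature { symbol :> Type; arity : symbol -> nat }.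

Definition algebra_on (Sigma : signature) (A : Type) : Type :=
  forall s : Sigma, operation A (arity s).

Definition power_algebra (Sigma : signature) (A : Type)
    (opA : algebra_on Sigma A) (Y : Type) : algebra_on Sigma (Y -> A) :=
  fun s x y => opA s [ffun i => x i y].

Arguments power_algebra {Sigma A} opA Y _ _ _.

Definition homomorphism (Sigma : signature) (B C : Type)
    (opB : algebra_on Sigma B) (opC : algebra_on Sigma C) (h : B -> C) : Prop :=
  forall (s : Sigma) (x : {ffun 'I_(arity s) -> B}),
    h (opB s x) = opC s [ffun i => h (x i)].

Definition basic_operations (Sigma : signature) (A : Type)
    (opA : algebra_on Sigma A) : set (finop A) :=
  [set Finop (opA s) | s in [set: Sigma]].

Definition clone (A : Type) (F : set (finop A)) : Prop :=
  (forall (n : nat) (i : 'I_n), F (Finop (@proj A n i))) /\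
  (forall (m n : nat) (f : operation A m) (g : 'I_m -> operation A n),
     F (Finop f) -> (forall j, F (Finop (g j))) -> F (Finop (compose f g))).

Definition generated_clone (A : Type) (G : set (finop A)) : set (finop A) :=
  smallest (@clone A) G.

Definition commute (A : Type) (n m : nat)
    (f : operation A n) (g : operation A m) : Prop :=
  forall a : 'M[A]_(n, m),
    g [ffun j => f [ffun i => a i j]] = f [ffun i => g [ffun j => a i j]].

Arguments commute {A n m} f g.

Definition commutant (A : Type) (G : set (finop A)) : set (finop A) :=
  [set f | forall g, G g -> commute (finop_fun f) (finop_fun g)].

(* Main.v *)
Require Import Defs.
From mathcomp Require Import all_boot all_algebra.
From mathcomp Require Import boolp classical_sets.

(**
  A homomorphism [h : A^(A^n) -> A] and an operation [g] commuting with the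
  basic operations are two views of the same object.  A columnwise reading of
  an [n * m] matrix [a] turns [g : A^m -> A] into the homomorphism
  [phi |-> g (phi (column j of a))_j]; conversely, since [A^n] is finite, [h]
  is itself an operation of arity [m = #|A^n|], and the matrix whose columns
  are all the elements of [A^n] recovers it.  Under this translation
  [h f <> f (h pi_i)_i] says precisely that [f] fails to commute with [g] at
  the matrix [a].  So (2) says that every operation outside the clone is outside
  the bicommutant, the other inclusion being automatic.
*)

Lemma commute_sym (A : Type) (n m : nat) (f : operation A n)
    (g : operation A m) : Defs.commute f g -> Defs.commute g f.
Proof.
move=> fg a.
transitivity (f [ffun i => g [ffun j => trmx a i j]]).
  congr (f _); apply/ffunP => i; rewrite !ffunE.
  by congr (g _); apply/ffunP => j; rewrite !ffunE mxE.
rewrite -(fg (trmx a)); congr (g _); apply/ffunP => j; rewrite !ffunE.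
by congr (f _); apply/ffunP => i; rewrite !ffunE mxE.
Qed.

Lemma commutant_clone (A : Type) (G : set (finop A)) : clone (commutant G).
Proof.
split=> [n i g _ a | m n f g Gf Gg k Gk a] /=.
  rewrite /proj ffunE; congr (finop_fun g _).
  by apply/ffunP => j; rewrite !ffunE.
rewrite /compose.
(* Row [l] holds the values of [g l] on the columns of [a]: [f] commutes with [k] on this matrix,
   then each [g l] does on [a]. *)
have /= := Gf k Gk (\matrix_(l, j) g l [ffun i => a i j])%R => fk.
transitivity (f [ffun l => finop_fun k
    [ffun j => (\matrix_(l, j) g l [ffun i => a i j])%R l j]]).
  rewrite -fk; congr (finop_fun k _); apply/ffunP => j; rewrite !ffunE.
  by congr (f _); apply/ffunP => l; rewrite !ffunE mxE.
congr (f _); apply/ffunP => l; rewrite !ffunE; have /= <- := Gg l k Gk a.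
by congr (finop_fun k _); apply/ffunP => j; rewrite !ffunE mxE.
Qed.

Lemma sub_bicommutant (A : Type) (G : set (finop A)) :
  (G `<=` commutant (commutant G))%classic.
Proof. by move=> f Gf g Gg; apply/commute_sym/Gg. Qed.

Lemma generated_clone_sub_bicommutant (A : Type) (G : set (finop A)) :
  (generated_clone G `<=` commutant (commutant G))%classic.
Proof. exact: smallest_sub (commutant_clone _ _) (sub_bicommutant _ _). Qed.

(** Evaluation at the points [y j] is a homomorphism from [A^Y] to [A^m], and [g] is one from [A^m]
    to [A]. *)
Lemma commutant_homomorphism (Sigma : signature) (A Y : Type)
    (opA : algebra_on Sigma A) (m : nat) (g : operation A m) (y : 'I_m -> Y) :
  commutant (basic_operations opA) (Finop g) ->
  homomorphism (power_algebra opA Y) opA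
    (fun phi : Y -> A => g [ffun j => phi (y j)]).
Proof.
move=> Cg s x; rewrite /power_algebra.
have Bs : basic_operations opA (Finop (opA s)) by exists s.
have /= gs := Cg _ Bs (\matrix_(j, i) x i (y j))%R.
transitivity (g [ffun j => opA s
    [ffun i => (\matrix_(j, i) x i (y j))%R j i]]).
  congr (g _); apply/ffunP => j; rewrite !ffunE.
  by congr (opA s _); apply/ffunP => i; rewrite !ffunE mxE.
rewrite -gs; congr (opA s _); apply/ffunP => i; rewrite !ffunE.
by congr (g _); apply/ffunP => j; rewrite !ffunE mxE.
Qed.

Lemma homomorphism_commutant (Sigma : signature) (A : Type) (Y : finType)
    (opA : algebra_on Sigma A) (h : (Y -> A) -> A) :
  homomorphism (power_algebra opA Y) opA h ->
  commutant (basic_operations opA)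
    (Finop (fun v : {ffun 'I_#|Y| -> A} => h (fun y => v (enum_rank y)))).
Proof.
move=> hom_h _ [s _ <-] a /=.
(* Column [i] of [a], reindexed by [Y], serves as the [i]-th argument in [A^Y]. *)
have := hom_h s [ffun i => fun y => a (enum_rank y) i].
rewrite /power_algebra => hs.
transitivity (opA s [ffun i =>
    h ([ffun i => fun y => a (enum_rank y) i] i)]).
  congr (opA s _); apply/ffunP => i; rewrite !ffunE.
  by congr h; apply/funext => y; rewrite ffunE.
rewrite -hs; congr h; apply/funext => y; rewrite ffunE.
by congr (opA s _); apply/ffunP => i; rewrite !ffunE.
Qed.

Theorem corollary6p7 (Sigma : signature) (A : finType)
    (opA : algebra_on Sigma A) :
  commutant (commutant (basic_operations opA))
    = generated_clone (basic_operations opA)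
  <->
  (forall (n : nat) (f : operation A n),
     ~ generated_clone (basic_operations opA) (Finop f) ->
     exists h : operation A n -> A,
       homomorphism (power_algebra opA {ffun 'I_n -> A}) opA h /\
       h f <> f [ffun i => h (proj i)]).
Proof.
split=> [<- n f | sep].
  move=> /existsNP [[m g]] /not_implyP [Cg] /existsNP [a] nfg.
  (* This map sends [proj i] to [g] of row [i] of [a]. *)
  exists (fun phi => g [ffun j => phi [ffun i => a i j]]).
  split; first exact: commutant_homomorphism Cg.
  move=> hf; apply: nfg => /=; rewrite hf.
  congr (f _); apply/ffunP => i; rewrite !ffunE.
  by congr (g _); apply/ffunP => j; rewrite /proj !ffunE.
apply/seteqP; split; last exact: generated_clone_sub_bicommutant.
move=> [n f] Cf; apply: contrapT => /sep [h [hom_h]]; apply.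
(* The columns run through all of [A^n], so row [i] is [proj i] and [f] applied columnwise is [f]
   itself, up to [enum_rank]. *)
have /= := Cf _ (homomorphism_commutant _ _ _ _ _ hom_h)
  (\matrix_(i, j) (enum_val j : {ffun 'I_n -> A}) i)%R.
set b := (\matrix_(_, _) _)%R => fh.
transitivity (h (fun y => [ffun j => f [ffun i => b i j]] (enum_rank y))).
  congr h; apply/funext => y; rewrite ffunE; congr (f _).
  by apply/ffunP => i; rewrite ffunE mxE enum_rankK.
rewrite fh; congr (f _); apply/ffunP => i; rewrite !ffunE.
by congr h; apply/funext => y; rewrite ffunE mxE enum_rankK.
Qed.
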